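(* Let $Q\subset\mathbb{R}^d$ be a compact convex polyhedron, and let $f:Q\to\mathbb{R}$ be a continuous convex function with $\|f\|_{\mathrm{Lip}}=L<\infty$. Given a function $f_n:Q\to\mathbb{R}$ (an estimator of $f$) and $\delta_n>0$, there exists a finite set $\mathcal{M}_n\subset Q$ such that any $x\in Q$ is a convex combination of points of $\mathcal{M}_n$ whose distance to $x$ is not more than $\delta_n$, and such that the convex estimator $f^c_n$ associated with $f_n$ and $\mathcal{M}_n$ satisfies $$\|f^c_n-f\|_\infty\le\|f_n-f\|_\infty+L\delta_n .$$
   Context: $|x-y|$ denotes the Euclidean distance in $\mathbb{R}^d$, $\|f\|_{\mathrm{Lip}}=\sup\{|f(x)-f(y)|/|x-y| : x,y\in Q,\ x\neq y\}$, and $\|g\|_\infty=\sup_{x\in Q}|g(x)|$. $Q$ is a (nonempty) bounded closed convex polyhedron, i.e. the convex hull of its finite set of vertices. $\mathscr{C}$ denotes the set of finite real-valued convex functions defined on $Q$. For $f_n:Q\to\mathbb{R}$ and a finite set $\mathcal{M}_n\subset Q$ whose convex hull is $Q$ (which is automatic under the condition on $\mathcal{M}_n$ in the claim), put $$\mathscr{L}_n=\{\psi\in\mathscr{C} : \psi(x)\le f_n(x)\text{ for all }x\in\mathcal{M}_n\}.$$ The convex estimator associated with $f_n$ and $\mathcal{M}_n$ is the pointwise supremum $f^c_n=\sup\{\psi : \psi\in\mathscr{L}_n\}$ on $Q$. Here $n$ is a fixed index; no relation between $n$ and the number of points of $\mathcal{M}_n$ is assumed. *)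

(* Defs.v *)
From HB Require Import structures.
From mathcomp Require Import all_boot all_order all_algebra.
From mathcomp Require Import all_classical all_reals all_analysis.

Set Implicit Arguments.
Unset Strict Implicit.
Unset Printing Implicit Defensive.

Import Order.TTheory GRing.Theory Num.Theory numFieldNormedType.Exports.

Local Open Scope classical_set_scope.
Local Open Scope ring_scope.

(* Points of R^d are row vectors. The library norm `|x - y| on 'rV[R]_d is the
   sup norm, hence the explicit Euclidean distance. Functions on Q are total
   functions on 'rV[R]_d of which only the values on Q are ever used. *)
Section ConvexEstimator.
Context {R : realType} {d : nat}.
Implicit Types (A Q M : set 'rV[R]_d) (x y : 'rV[R]_d) (f g : 'rV[R]_d -> R).

Definition euclid_dist x y : R :=
  Num.sqrt (\sum_(i < d) (x ord0 i - y ord0 i) ^+ 2).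

(* The finite convex combinations of points of A. *)
Definition convex_hull A : set 'rV[R]_d :=
  [set x | exists (k : nat) (p : 'I_k -> 'rV[R]_d) (w : 'I_k -> R),
    [/\ forall i, A (p i),
        forall i, 0 <= w i,
        \sum_(i < k) w i = 1 &
        x = \sum_(i < k) w i *: p i]].

(* The vertices of a convex set are its extreme points. *)
Definition vertices Q : set 'rV[R]_d :=
  [set v | Q v /\
    forall (x y : 'rV[R]_d) (t : R), Q x -> Q y -> 0 < t -> t < 1 ->
      v = t *: x + (1 - t) *: y -> x = v /\ y = v].

Definition compact_convex_polyhedron Q : Prop :=
  [/\ Q !=set0, finite_set (vertices Q) & Q = convex_hull (vertices Q)].

Definition convex_on Q f : Prop := @convex_function R 'rV[R]_d Q f.

Local Open Scope ereal_scope.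

(* The supremum is over nonnegative quantities and is therefore 0 when there is
   no pair of distinct points in Q; the added 0 implements this, since
   ereal_sup set0 = -oo. *)
Definition lip_norm Q f : \bar R :=
  ereal_sup (0 |` [set r | exists x y,
    [/\ Q x, Q y, x <> y & r = (`|f x - f y|%R / euclid_dist x y)%:E]]).

Definition sup_norm Q (g : 'rV[R]_d -> \bar R) : \bar R :=
  ereal_sup [set `|g x| | x in Q].

Definition convex_minorants Q f M : set ('rV[R]_d -> R) :=
  [set psi | convex_on Q psi /\ forall x, M x -> (psi x <= f x)%R].

(* A pointwise supremum in the extended reals, so that no convention for
   unbounded or empty families is needed. *)
Definition convex_estimator Q f M : 'rV[R]_d -> \bar R :=
  fun x => ereal_sup [set (psi x)%:E | psi in convex_minorants Q f M].

End ConvexEstimator.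

(* Main.v *)
Require Import Defs.
From HB Require Import structures.
From mathcomp Require Import all_boot all_order all_algebra.
From mathcomp Require Import all_classical all_reals all_analysis.
From mathcomp Require Import ring lra.

Set Implicit Arguments.
Unset Strict Implicit.
Unset Printing Implicit Defensive.

Import Order.TTheory GRing.Theory Num.Theory numFieldNormedType.Exports.

Local Open Scope classical_set_scope.
Local Open Scope ring_scope.

(** The set M is a fine lattice in Q. Let V be the matrix whose rows are the
    vertices of Q, so that the points of Q are the w *m V with w in the
    standard simplex, and take for M the points (v / N) *m V, where v runs over
    the nonnegative integer vectors of sum N. That a point w *m V is a convex
    combination of nearby points of M comes from rounding N *: w: an integral
    box cut by a hyperplane of integral coordinate sum is the convex hull of its
    integer points ([box_slice_integral]). Applied to the box of the floors and
    ceilings of the coordinates of N *: w, this writes N *: w as a convex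
    combination of integer vectors of sum N at coordinatewise distance at most
    1; dividing by N, the corresponding points of M are at distance O(1/N) from
    w *m V ([simplex_image_net]).

    For the estimate, let e be the sup norm of fn - f, which may be assumed
    finite since otherwise the bound is +oo. As f - e is convex and below fn on
    M, the estimator is at least f - e ([estimator_ge]). Conversely, write x as a convex combination of points p of
    M at distance at most delta. By Jensen's inequality a convex minorant psi of
    fn on M satisfies psi x <= sum of w_p * fn p, and
    fn p <= f p + e <= f x + L * delta + e ([estimator_le]). *)

(** * Convex hulls and Jensen's inequality *)

Section ConvexHull.
Context {R : realType}.

Lemma sub_convex_hull d (A B : set 'rV[R]_d) : A `<=` B ->
  convex_hull A `<=` convex_hull B.
Proof.
move=> AB x [k [p [w [Ap w0 w1 ->]]]].
by exists k, p, w; split=> // i; exact: AB.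
Qed.

Lemma subset_convex_hull d (A : set 'rV[R]_d) : A `<=` convex_hull A.
Proof.
move=> x Ax; exists 1, (fun=> x), (fun=> 1).
by split=> //; rewrite big_ord1 ?scale1r.
Qed.

Lemma convex_hull_mulmx m d (A : set 'rV[R]_m) (B : 'M[R]_(m, d)) x :
  convex_hull A x -> convex_hull [set a *m B | a in A] (x *m B).
Proof.
move=> [k [p [w [Ap w0 w1 ->]]]].
exists k, (fun i => p i *m B), w; split=> //; first by move=> i; exists (p i).
by rewrite mulmx_suml; apply: eq_bigr => i _; rewrite scalemxAl.
Qed.

Lemma convex_hull_avg d (A : set 'rV[R]_d) x y (t : R) :
  convex_hull A x -> convex_hull A y -> 0 <= t -> t <= 1 ->
  convex_hull A (t *: x + (1 - t) *: y).
Proof.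
move=> [k [p [w [Ap w0 w1 ->]]]] [l [q [v [Aq v0 v1 ->]]]] t0 t1.
exists (k + l)%N,
  (fun i => match fintype.split i with inl a => p a | inr b => q b end),
  (fun i => match fintype.split i with
            | inl a => t * w a
            | inr b => (1 - t) * v b
            end).
split.
- by move=> i; case: fintype.split.
- by move=> i; case: fintype.split => a; rewrite mulr_ge0// subr_ge0.
- rewrite big_split_ord/=.
  under eq_bigr do rewrite (unsplitK (inl _)).
  under [X in _ + X]eq_bigr do rewrite (unsplitK (inr _)).
  by rewrite -!mulr_sumr w1 v1 !mulr1 addrC subrK.
- rewrite big_split_ord/= !scaler_sumr; congr (_ + _); apply: eq_bigr => i _.
  + by rewrite (unsplitK (inl _)) scalerA.
  + by rewrite (unsplitK (inr _)) scalerA.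
Qed.

Lemma convex_set_hull d (A : set 'rV[R]_d) :
  @convex_set R 'rV[R]_d (convex_hull A).
Proof.
move=> x y t; rewrite !inE => Ax Ay.
by apply: (convex_hull_avg Ax Ay).
Qed.

(** The induction averages the first point with the combination of the others,
    their weights rescaled by their sum s. Convexity of g on Q applies to this
    average only if the combination of the others is in Q, so the two
    conclusions are proved together. *)
Lemma jensen d (Q : set 'rV[R]_d) (g : 'rV[R]_d -> R) k
    (p : 'I_k -> 'rV[R]_d) (w : 'I_k -> R) :
  @convex_set R 'rV[R]_d Q -> convex_on Q g ->
  (forall i, Q (p i)) -> (forall i, 0 <= w i) -> \sum_(i < k) w i = 1 ->
  Q (\sum_(i < k) w i *: p i) /\
  g (\sum_(i < k) w i *: p i) <= \sum_(i < k) w i * g (p i).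
Proof.
move=> cQ cg; elim: k => [|k IH] in p w * => Qp w0.
  by rewrite big_ord0 => /eqP; rewrite eq_sym oner_eq0.
rewrite !big_ord_recl; set s := \sum_(i < k) _ => ws.
have s0 : 0 <= s by apply: sumr_ge0.
have w1 : w ord0 <= 1 by rewrite -ws lerDl.
have [s_eq0|s_neq0] := eqVneq s 0.
  have wl i : w (lift ord0 i) = 0.
    by move/eqP: s_eq0; rewrite psumr_eq0// => /allP/(_ i)/= /(_ (mem_index_enum _))/eqP.
  rewrite !big1 => [|i _|i _]; rewrite ?wl ?scale0r ?mul0r//.
  by move: ws; rewrite s_eq0 !addr0 => ->; rewrite scale1r mul1r; split.
pose v i := w (lift ord0 i) / s.
have [|||Qr gr] := IH (fun i => p (lift ord0 i)) v.
- by move=> i; exact: Qp.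
- by move=> i; rewrite divr_ge0.
- by rewrite -mulr_suml divff.
pose r := \sum_(i < k) v i *: p (lift ord0 i).
have -> : \sum_(i < k) w (lift ord0 i) *: p (lift ord0 i) = (1 - w ord0) *: r.
  rewrite -ws addrAC subrr add0r scaler_sumr; apply: eq_bigr => i _.
  by rewrite scalerA mulrC divfK.
have -> : \sum_(i < k) w (lift ord0 i) * g (p (lift ord0 i)) =
    (1 - w ord0) * \sum_(i < k) v i * g (p (lift ord0 i)).
  rewrite -ws addrAC subrr add0r mulr_sumr; apply: eq_bigr => i _.
  by rewrite mulrA [s * _]mulrC divfK.
pose t := Itv01 (w0 ord0) w1.
split; first by have := cQ (p ord0) r t; rewrite !inE; exact.
have : g (w ord0 *: p ord0 + (1 - w ord0) *: r) <=
    w ord0 * g (p ord0) + (1 - w ord0) * g r.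
  by apply: (cg t); rewrite inE.
move/le_trans; apply; rewrite lerD2l ler_wpM2l ?subr_ge0//.
Qed.

End ConvexHull.

(** * Integrality of box slices *)

Section Slice.
Context {R : realType} {k : nat}.
Implicit Types (lo hi : 'I_k -> R) (N : R) (u : 'rV[R]_k).

Definition box_slice lo hi N : set 'rV[R]_k :=
  [set u | (forall i, lo i <= u ord0 i <= hi i) /\ \sum_(i < k) u ord0 i = N].

Definition nonint_coords u := [set i | u ord0 i \isn't a Num.int]%SET.

Lemma int_le_floor (m a : R) : m \is a Num.int -> m <= a ->
  m <= (Num.floor a)%:~R.
Proof. by move=> /intrP[n ->]; rewrite ler_int floor_ge_int. Qed.

Lemma int_ge_ceil (m a : R) : m \is a Num.int -> a <= m ->
  (Num.ceil a)%:~R <= m.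
Proof. by move=> /intrP[n ->]; rewrite ler_int ceil_le_int. Qed.

Lemma nonint_floor_lt (a : R) : a \isn't a Num.int -> (Num.floor a)%:~R < a.
Proof. by rewrite intrEfloor lt_neqAle floor_le andbT. Qed.

Lemma nonint_ceil_gt (a : R) : a \isn't a Num.int -> a < (Num.ceil a)%:~R.
Proof. by rewrite intrEceil lt_neqAle ceil_ge eq_sym andbT. Qed.

(** Moving mass from coordinate j to coordinate i preserves the sum; the largest
    s for which coordinate i stays below its ceiling and coordinate j above its
    floor makes one of the two integral. The point cannot leave the box on the
    way because the bounds of the box are integers. *)
Lemma transfer_step lo hi N u (i j : 'I_k) :
  (forall l, lo l \is a Num.int) -> (forall l, hi l \is a Num.int) ->
  box_slice lo hi N u -> i != j ->
  i \in nonint_coords u -> j \in nonint_coords u ->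
  exists2 s, 0 < s & let u' := u + s *: (delta_mx ord0 i - delta_mx ord0 j) in
    box_slice lo hi N u' /\ (#|nonint_coords u'| < #|nonint_coords u|)%N.
Proof.
move=> loZ hiZ [ub uN] ij; rewrite !inE => iF jF.
pose si := (Num.ceil (u ord0 i))%:~R - u ord0 i.
pose sj := u ord0 j - (Num.floor (u ord0 j))%:~R.
pose s := Num.min si sj.
pose u' := u + s *: (delta_mx ord0 i - delta_mx ord0 j).
have si0 : 0 < si by rewrite subr_gt0 nonint_ceil_gt.
have sj0 : 0 < sj by rewrite subr_gt0 nonint_floor_lt.
have s0 : 0 < s by rewrite lt_min si0.
have u'i : u' ord0 i = u ord0 i + s.
  by rewrite !mxE !eqxx (negbTE ij) subr0 mulr1.
have u'j : u' ord0 j = u ord0 j - s.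
  by rewrite !mxE !eqxx eq_sym (negbTE ij) sub0r mulrN1.
have u'l l : l != i -> l != j -> u' ord0 l = u ord0 l.
  by move=> li lj; rewrite !mxE (negbTE li) (negbTE lj) subrr mulr0 addr0.
have ssi : s <= si by rewrite ge_min lexx.
have ssj : s <= sj by rewrite ge_min lexx orbT.
exists s => //=; rewrite -/u'; split; first split.
- move=> l; have [->|li] := eqVneq l i.
    rewrite u'i; have /andP[h1 h2] := ub i; apply/andP; split.
      by rewrite (le_trans h1)// lerDl ltW.
    by apply: le_trans (int_ge_ceil (hiZ i) h2); rewrite -lerBrDl.
  have [->|lj] := eqVneq l j.
    rewrite u'j; have /andP[h1 h2] := ub j; apply/andP; split.
      by apply: (le_trans (int_le_floor (loZ j) h1)); rewrite lerBrDl -lerBrDr.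
    by rewrite (le_trans _ h2)// gerBl ltW.
  by rewrite u'l.
- rewrite -uN (bigD1 i)//= (bigD1 j) 1?eq_sym//= [RHS](bigD1 i)//=.
  rewrite [X in _ = _ + X](bigD1 j) 1?eq_sym//= u'i u'j.
  rewrite (eq_bigr (fun l => u ord0 l)); first by ring.
  by move=> l /andP[li lj]; exact: u'l.
- apply: proper_card; apply/properP; split.
    apply/fintype.subsetP => l; rewrite !inE.
    have [->//|li] := eqVneq l i; have [->//|lj] := eqVneq l j.
    by rewrite u'l.
  have [le_ij|lt_ji] := leP si sj.
    exists i; rewrite !inE// negbK u'i /s min_l// /si addrC subrK.
    exact: intr_int.
  exists j; rewrite !inE// negbK u'j /s min_r ?(ltW lt_ji)// /sj opprB addrC subrK.
  exact: intr_int.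
Qed.

(** If a coordinate i of u is not an integer then some other coordinate j is
    not an integer either, because the sum N is one. Transferring mass from j to i, and from i
    to j, gives two points of the slice with fewer non-integral coordinates, and
    u lies on the segment between them. *)
Lemma box_slice_integral lo hi N u :
  (forall l, lo l \is a Num.int) -> (forall l, hi l \is a Num.int) ->
  N \is a Num.int -> box_slice lo hi N u ->
  convex_hull [set v | box_slice lo hi N v /\
                       forall i, v ord0 i \is a Num.int] u.
Proof.
move=> loZ hiZ NZ.
have [n] := ubnP #|nonint_coords u|; elim: n u => // n IH u; rewrite ltnS => un uB.
have [F0|[i iF]] := set_0Vmem (nonint_coords u).
  apply: subset_convex_hull; split=> // i.
  by move/setP/(_ i): F0; rewrite !inE => /negbFE.
have [j ij jF] : exists2 j, i != j & j \in nonint_coords u.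
  apply: contrapT => nj; move: (iF); rewrite inE => /negP; apply.
  have -> : u ord0 i = N - \sum_(l < k | l != i) u ord0 l.
    by case: uB => _ <-; rewrite (bigD1 i)//= addrK.
  rewrite rpredB// rpred_sum// => l li; apply: contrapT => lF; apply: nj.
  by exists l; [rewrite eq_sym|rewrite inE; apply/negP].
have [s s0 [sB sF]] := transfer_step loZ hiZ uB ij iF jF.
have [|t t0 [tB tF]] := transfer_step loZ hiZ uB _ jF iF; first by rewrite eq_sym.
have st0 : 0 < s + t by rewrite addr_gt0.
(* The two points are u + s *: D and u - t *: D for the same direction D, so the
   first has weight t / (s + t). *)
have -> : u = (t / (s + t)) *: (u + s *: (delta_mx ord0 i - delta_mx ord0 j)) +
    (1 - t / (s + t)) *: (u + t *: (delta_mx ord0 j - delta_mx ord0 i)).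
  apply/rowP => l; rewrite !mxE; field; exact: lt0r_neq0.
apply: convex_hull_avg.
- exact/IH/sB/(leq_trans sF).
- exact/IH/tB/(leq_trans tF).
- by rewrite divr_ge0 ?ltW.
- by rewrite ler_pdivrMr// mul1r lerDr ltW.
Qed.

End Slice.

(** * Finite nets in a polytope *)

Section Net.
Context {R : realType}.

Definition simplex {m} : set 'rV[R]_m :=
  [set w | (forall i, 0 <= w ord0 i) /\ \sum_(i < m) w ord0 i = 1].

(** The points of a convex combination are unrelated to an enumeration of A and
    may repeat; summing the unit vectors of their indices, with the same
    weights, collects the weight of each element of A. *)
Lemma convex_hull_finite d (A : set 'rV[R]_d) : finite_set A ->
  exists m (V : 'M[R]_(m, d)), convex_hull A = [set w *m V | w in simplex].
Proof.
move=> /finite_seqP[s ->]; exists (size s), (\matrix_(i < size s) s`_i).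
apply/seteqP; split=> x.
  move=> [k [p [w [ps w0 w1 ->]]]].
  have idx_lt i : (index (p i) s < size s)%N by rewrite index_mem; exact: ps.
  pose e i : 'rV[R]_(size s) := delta_mx ord0 (Ordinal (idx_lt i)).
  have e_sum i : \sum_l e i ord0 l = 1.
    rewrite (bigD1 (Ordinal (idx_lt i)))//= big1 ?addr0 ?mxE ?eqxx// => l.
    by rewrite mxE eqxx => /negbTE ->.
  exists (\sum_(i < k) w i *: e i); first split.
  - move=> l; rewrite summxE sumr_ge0// => i _.
    by rewrite !mxE mulr_ge0.
  - under eq_bigr do rewrite summxE; rewrite exchange_big -w1/=.
    apply: eq_bigr => i _; under eq_bigr do rewrite mxE.
    by rewrite -mulr_sumr e_sum mulr1.
  - rewrite mulmx_suml; apply: eq_bigr => i _.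
    by rewrite -scalemxAl -rowE rowK/= nth_index//; exact: ps.
move=> [w [w0 w1] <-]; exists (size s), (fun i => s`_i), (w ord0).
split=> // [i|]; first exact: mem_nth.
by rewrite mulmx_sum_row; apply: eq_bigr => i _; rewrite rowK.
Qed.

Lemma euclid_dist_mulmx m d (V : 'M[R]_(m, d)) (u v : 'rV[R]_m) (e : R) :
  (forall i, `|u ord0 i - v ord0 i| <= e) -> 0 <= e ->
  euclid_dist (u *m V) (v *m V) <=
    e * Num.sqrt (\sum_(j < d) (\sum_(i < m) `|V i j|) ^+ 2).
Proof.
move=> uv e0; rewrite -[X in X * _](ger0_norm e0) -sqrtr_sqr -sqrtrM ?sqr_ge0//.
rewrite ler_sqrt; last by rewrite mulr_ge0 ?sqr_ge0 ?sumr_ge0// => j _; rewrite sqr_ge0.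
rewrite mulr_sumr; apply: ler_sum => j _; rewrite -exprMn -ler_sqrt ?sqr_ge0//.
rewrite !sqrtr_sqr [leRHS]ger0_norm ?mulr_ge0 ?sumr_ge0//.
rewrite !mxE -sumrB mulr_sumr (le_trans (ler_norm_sum _ _ _))//.
by apply: ler_sum => i _; rewrite -mulrBl normrM ler_wpM2r.
Qed.

Lemma finite_lattice_slice m n :
  finite_set [set v : 'rV[R]_m |
    box_slice (fun=> 0) (fun=> n%:R) n%:R v /\
    forall i, v ord0 i \is a Num.int].
Proof.
pose r (c : {ffun 'I_m -> 'I_n.+1}) : 'rV[R]_m := \row_i (c i)%:R.
apply: (@sub_finite_set _ _ (r @` setT)); last exact: finite_image.
move=> v [[vb _] vZ]; exists [ffun i => inord (Num.trunc (v ord0 i))] => //.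
apply/rowP => i; rewrite mxE ffunE; have /andP[v0 vn] := vb i.
have vN : v ord0 i \is a Num.nat by rewrite natrEint vZ.
by rewrite inordK ?truncnK// ltnS -(ler_nat R) truncnK.
Qed.

(** The net is the image under V of the simplex points with coordinates in
    (1/n) Z, for n large enough that C / n <= delta, where C bounds the
    Euclidean distance travelled when every coordinate moves by at most 1. *)
Lemma simplex_image_net m d (V : 'M[R]_(m, d)) (delta : R) : 0 < delta ->
  exists M : set 'rV[R]_d,
    [/\ finite_set M, M `<=` [set w *m V | w in simplex] &
      forall w, simplex w ->
        convex_hull [set y | M y /\ euclid_dist (w *m V) y <= delta] (w *m V)].
Proof.
move=> delta0; pose C := Num.sqrt (\sum_(j < d) (\sum_(i < m) `|V i j|) ^+ 2).
pose n := (Num.trunc (C / delta)).+1; pose N : R := n%:R.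
have N0 : 0 < N by rewrite ltr0n.
have NC : N^-1 * C <= delta.
  by rewrite ler_pdivrMl// -ler_pdivrMr// ltW// truncnS_gt.
pose P := [set v : 'rV[R]_m |
  box_slice (fun=> 0) (fun=> N) N v /\ forall i, v ord0 i \is a Num.int].
exists [set v *m (N^-1 *: V) | v in P]; split.
- exact/finite_image/finite_lattice_slice.
- move=> _ [v [[vb vN] _] <-]; exists (N^-1 *: v).
    split=> [i|].
      by rewrite mxE mulr_ge0 ?invr_ge0 ?(ltW N0)//; case/andP: (vb i).
    under eq_bigr do rewrite mxE.
    by rewrite -mulr_sumr vN mulVf// gt_eqF.
  by rewrite -scalemxAl scalemxAr.
move=> w [w0 w1]; pose u := N *: w.
have u0 i : 0 <= u ord0 i by rewrite mxE mulr_ge0// ltW.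
pose lo i : R := (Num.floor (u ord0 i))%:~R.
pose hi i : R := (Num.ceil (u ord0 i))%:~R.
have uB : box_slice lo hi N u.
  split=> [i|]; first by rewrite floor_le ceil_ge.
  by under eq_bigr do rewrite mxE; rewrite -mulr_sumr w1 mulr1.
have -> : w *m V = u *m (N^-1 *: V).
  by rewrite -scalemxAl -scalemxAr scalerA divff ?scale1r// gt_eqF.
have uH := box_slice_integral (fun=> intr_int _ _) (fun=> intr_int _ _)
  (rpred_nat _ n) uB.
have := convex_hull_mulmx (N^-1 *: V) uH; apply: sub_convex_hull.
move=> _ [v [[vb vN] vZ] <-].
have v0 i : 0 <= v ord0 i.
  have /andP[+ _] := vb i; apply: le_trans.
  by rewrite ler0z floor_ge0.
split.
  exists v => //; split=> //; split=> // i; rewrite v0/=.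
  by rewrite -[leRHS]vN (bigD1 i)//= lerDl sumr_ge0.
rewrite -!scalemxAr !scalemxAl; apply: le_trans NC.
apply: euclid_dist_mulmx; last by rewrite invr_ge0 ltW.
move=> i; have scaleE (z : 'rV[R]_m) : (N^-1 *: z) ord0 i = N^-1 * z ord0 i.
  by rewrite mxE.
rewrite !scaleE -mulrBr normrM ger0_norm ?invr_ge0 ?(ltW N0)//.
rewrite ler_piMr ?invr_ge0 ?(ltW N0)//.
have /andP[lv vh] := vb i.
have := floor_itv (u ord0 i); have := ceil_itv (u ord0 i).
rewrite intrB intrD -/(lo i) -/(hi i) => /andP[h1 h2] /andP[h3 h4].
rewrite ler_norml; lra.
Qed.

End Net.

(** * The convex estimator *)

Section Estimator.
Context {R : realType} {d : nat}.
Implicit Types (Q M : set 'rV[R]_d) (f fn : 'rV[R]_d -> R).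

Lemma lip_norm_ge0 Q f (L : R) : lip_norm Q f = L%:E -> 0 <= L.
Proof. by move=> fL; rewrite -lee_fin -fL; apply: ereal_sup_ubound; left. Qed.

Lemma lip_norm_le Q f (L : R) x y : lip_norm Q f = L%:E -> Q x -> Q y ->
  `|f x - f y| <= L * euclid_dist x y.
Proof.
move=> fL Qx Qy; have [->|xy] := eqVneq x y.
  by rewrite subrr normr0 mulr_ge0 ?(lip_norm_ge0 fL)// sqrtr_ge0.
have dist_gt0 : 0 < euclid_dist x y.
  rewrite sqrtr_gt0 lt_neqAle sumr_ge0 ?andbT// => [|i _]; last exact: sqr_ge0.
  rewrite eq_sym psumr_eq0 => [|i _]; last exact: sqr_ge0.
  apply: contra_neqN xy => /allP/= xy0; apply/rowP => i; apply/eqP.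
  by rewrite -subr_eq0 -sqrf_eq0 xy0 ?mem_index_enum.
rewrite -ler_pdivrMr// -lee_fin -fL; apply: ereal_sup_ubound; right.
by exists x, y; split=> //; exact/eqP.
Qed.

(** The function f - e is itself one of the minorants in the supremum. *)
Lemma estimator_ge Q M f fn (e : R) x : convex_on Q f ->
  (forall y, M y -> f y <= fn y + e) ->
  ((f x - e)%:E <= convex_estimator Q fn M x)%E.
Proof.
move=> cf fe; apply: ereal_sup_ubound; exists (fun y => f y - e) => //; split.
  move=> t y z Qy Qz; have := cf t y z Qy Qz; rewrite !convRE /unstable.onem.
  move=> /lerB/(_ (lexx e))/le_trans; apply; rewrite le_eqVlt; apply/orP; left.
  by apply/eqP; ring.
by move=> y My; rewrite lerBlDr fe.
Qed.

(** Jensen's inequality bounds every minorant at x by an average of values of fn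
    at points of M within delta of x. *)
Lemma estimator_le Q M f fn (e L delta : R) x :
  @convex_set R 'rV[R]_d Q -> M `<=` Q -> lip_norm Q f = L%:E ->
  Q x ->
  (forall y, M y -> fn y <= f y + e) ->
  convex_hull [set y | M y /\ euclid_dist x y <= delta] x ->
  (convex_estimator Q fn M x <= (f x + e + L * delta)%:E)%E.
Proof.
move=> cQ MQ fL Qx fe [k [p [w [pM w0 w1 xE]]]].
have L0 := lip_norm_ge0 fL.
apply: ge_ereal_sup => _ [psi [cpsi psiM] <-]; rewrite lee_fin.
have pQ i : Q (p i) by have [/MQ] := pM i.
have [_] := jensen cQ cpsi pQ w0 w1; rewrite -xE => psix.
apply: (le_trans psix).
rewrite -[leRHS]mul1r -w1 mulr_suml; apply: ler_sum => i _.
rewrite ler_wpM2l//; have [Mp dp] := pM i.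
rewrite (le_trans (psiM _ Mp))// (le_trans (fe _ Mp))//.
have := lip_norm_le fL Qx (MQ _ Mp); rewrite ler_norml => /andP[h _].
have := ler_wpM2l L0 dp; lra.
Qed.

End Estimator.

Theorem corollary1 (R : realType) (d : nat) (Q : set 'rV[R]_d)
    (f fn : 'rV[R]_d -> R) (L delta : R)
    (polyQ : compact_convex_polyhedron Q)
    (contf : {within Q, continuous f})
    (convf : convex_on Q f)
    (lipf : lip_norm Q f = L%:E)
    (delta_gt0 : 0 < delta) :
  exists M : set 'rV[R]_d,
    [/\ finite_set M,
        M `<=` Q,
        (forall x, Q x ->
           convex_hull [set y | M y /\ euclid_dist x y <= delta] x) &
        (sup_norm Q (fun x => convex_estimator Q fn M x - (f x)%:E)
           <= sup_norm Q (fun x => (fn x - f x)%:E) + (L * delta)%:E)%E].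
Proof.
case: polyQ => -[x0 Qx0] finV QE.
have cQ : @convex_set R 'rV[R]_d Q by rewrite QE; exact: convex_set_hull.
have [m [V hullE]] := convex_hull_finite finV.
have [M [finM MV Mnet]] := simplex_image_net V delta_gt0.
rewrite -hullE -QE in MV.
have Mhull x : Q x -> convex_hull [set y | M y /\ euclid_dist x y <= delta] x.
  by rewrite {1}QE hullE => -[w w_simplex <-]; exact: Mnet.
exists M; split=> //.
have fn_le x : Q x -> (`|fn x - f x|%:E <= sup_norm Q (fun x => (fn x - f x)%:E))%E.
  by move=> Qx; apply: ereal_sup_ubound; exists x.
case: (sup_norm Q (fun x => (fn x - f x)%:E)) fn_le => [e||] fn_le.
- apply: ge_ereal_sup => _ [x Qx <-].
  have fn_near y : M y -> f y <= fn y + e /\ fn y <= f y + e.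
    move=> /MV/fn_le; rewrite lee_fin ler_norml => /andP[]; lra.
  have L0 := lip_norm_ge0 lipf.
  have := estimator_ge x convf (fun y My => (fn_near y My).1).
  have := estimator_le cQ MV lipf Qx (fun y My => (fn_near y My).2) (Mhull x Qx).
  case: (convex_estimator Q fn M x) => [c| |]//.
  rewrite -EFinB -EFinD abse_EFin !lee_fin ler_norml => h1 h2.
  have := mulr_ge0 L0 (ltW delta_gt0); lra.
- by rewrite addye// leey.
- by have := fn_le _ Qx0.
Qed.
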